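(* Let $K>0$ be a real number with $K\neq 1$. Consider the seven matrices \[ A_1=\begin{pmatrix} K & 1 & 1 \\ 1 & K & 1 \\ 1 & 1 & K \end{pmatrix},\quad A_2=\begin{pmatrix} K & 1 & 1 \\ 1 & 1 & 1 \\ 1 & 1 & 1 \end{pmatrix},\quad A_3=\begin{pmatrix} 1 & 1 & 1 \\ 1 & K & K \\ 1 & K & K \end{pmatrix},\quad A_4=\begin{pmatrix} 1 & K & K \\ K & 1 & 1 \\ K & 1 & 1 \end{pmatrix}, \] \[ A_5=\begin{pmatrix} K & 1 & 1 \\ 1 & K & 1 \\ 1 & 1 & 1 \end{pmatrix},\quad A_6=\begin{pmatrix} K & K & 1 \\ K & 1 & 1 \\ 1 & 1 & 1 \end{pmatrix},\quad A_7=\begin{pmatrix} K & K & 1 \\ K & 1 & 1 \\ 1 & 1 & K \end{pmatrix}. \] Then $A_1,\ldots,A_7$ form a complete set of representatives of the seven equivalence classes (with respect to $\sim$) of symmetric $3\times 3$ matrices whose set of coordinates is $\{1,K\}$ and in which $K$ occurs at most four times. Moreover, the Sinkhorn limits of these matrices have the following shapes and coordinates. (1) $S(A_1)=\begin{pmatrix} a & b & b \\ b & a & b \\ b & b & a \end{pmatrix}$ with $a=\dfrac{K}{K+2}$ and $b=\dfrac{1}{K+2}$. (2) and (3) $S(A_2)=S(A_3)=\begin{pmatrix} a & b & b \\ b & c & c \\ b & c & c \end{pmatrix}$ with \[ a=\frac{2K+1-\sqrt{8K+1}}{2(K-1)},\qquad b=\frac{-3+\sqrt{8K+1}}{4(K-1)},\qquad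 c=\frac{4K-1-\sqrt{8K+1}}{8(K-1)}. \] (4) $S(A_4)=\begin{pmatrix} a & b & b \\ b & c & c \\ b & c & c \end{pmatrix}$ with \[ a=\frac{-K^2-2+K\sqrt{K^2+8}}{2(K^2-1)},\qquad b=\frac{3K^2-K\sqrt{K^2+8}}{4(K^2-1)},\qquad c=\frac{K^2-4+K\sqrt{K^2+8}}{8(K^2-1)}. \] (5) $S(A_5)=\begin{pmatrix} a & b & c \\ b & a & c \\ c & c & d \end{pmatrix}$ with \[ a=\frac{K\left(2K+1-\sqrt{4K+5}\right)}{2(K^2-1)},\quad b=\frac{2K+1-\sqrt{4K+5}}{2(K^2-1)},\quad c=\frac{\sqrt{2K+7-3\sqrt{4K+5}}}{\sqrt{2}\,(K-1)},\quad d=\frac{K+2-\sqrt{4K+5}}{K-1}. \] (6) $S(A_6)=\begin{pmatrix} a & b & c \\ b & c & a \\ c & a & b \end{pmatrix}$ with \[ a=\frac{K^{2/3}-K^{1/3}}{K-1},\qquad b=\frac{K-K^{2/3}}{K-1},\qquad c=\frac{K^{1/3}-1}{K-1}. \] (7) $S(A_7)$ has the shape $\begin{pmatrix} a & b & c \\ b & d & e \\ c & e & f \end{pmatrix}$.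
   Context: A matrix is positive if all its coordinates (entries) are positive. A nonnegative square matrix is doubly stochastic if all its row sums and all its column sums equal $1$. A diagonal matrix is positive diagonal if its diagonal entries are all positive. For every positive $n\times n$ matrix $A$ there exist positive diagonal $n\times n$ matrices $X,Y$ such that $XAY$ is doubly stochastic, and the matrix $XAY$ is uniquely determined by $A$; it is called the Sinkhorn limit of $A$ and denoted $S(A)$. (It is also the limit of the process of alternately row scaling and column scaling $A$, i.e. dividing each row by its row sum and then each column by its column sum.) If $A$ is also symmetric, there is a unique positive diagonal matrix $X$ such that $XAX$ is doubly stochastic, and then $S(A)=XAX$. For positive $n\times n$ matrices $A,B$, write $A\sim B$ if there exist $n\times n$ permutation matrices $P,Q$ and a real number $\lambda>0$ such that $B=\lambda PAQ$; this is an equivalence relation. In each shape, equal letters denote equal coordinates, and the letters are chosen separately for each matrix.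
   Formalization: In item (5), the denominator of c is √2·|K−1| instead of √2·(K−1): the printed c is negative for 0<K<1 (e.g. K=5/16 gives −4/11), which is impossible for a doubly stochastic matrix; for K>1 the two formulas agree. *)

(* Defs.v *)
From HB Require Import structures.
From mathcomp Require Import all_boot all_order all_algebra.
From mathcomp Require Import all_classical all_reals all_analysis.
From mathcomp Require Import ring lra.

Set Implicit Arguments.
Unset Strict Implicit.
Unset Printing Implicit Defensive.

Import Order.TTheory GRing.Theory Num.Theory.
Import numFieldNormedType.Exports.

Local Open Scope classical_set_scope.
Local Open Scope ring_scope.

Definition positive_mx (R : realType) (m n : nat) (A : 'M[R]_(m, n)) : Prop :=
  forall i j, 0 < A i j.

Definition doubly_stochastic (R : realType) (n : nat) (A : 'M[R]_n) : Prop :=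
  [/\ forall i j, 0 <= A i j,
      forall i, \sum_j A i j = 1
    & forall j, \sum_i A i j = 1].

Definition positive_diagonal (R : realType) (n : nat) (X : 'M[R]_n) : Prop :=
  is_diag_mx X /\ forall i, 0 < X i i.

Definition sinkhorn_scaling (R : realType) (n : nat) (A S : 'M[R]_n) : Prop :=
  doubly_stochastic S /\
  exists X Y : 'M[R]_n,
    [/\ positive_diagonal X, positive_diagonal Y & S = X *m A *m Y].

(* S(A). For positive [A] the scaling exists and is unique ([sinkhornP] below),
   so the default value 0 is never used. *)
Definition sinkhorn (R : realType) (n : nat) (A : 'M[R]_n) : 'M[R]_n :=
  xget 0 [set S | sinkhorn_scaling A S].

Definition mx_sim (R : realType) (n : nat) (A B : 'M[R]_n) : Prop :=
  exists (P Q : 'M[R]_n) (lambda : R),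
    [/\ is_perm_mx P, is_perm_mx Q, 0 < lambda
      & B = lambda *: (P *m A *m Q)].

(* [f] lists, without repetition, one representative of each class of the
   restriction of the equivalence relation [e] to [D]. *)
Definition complete_representatives (T I : Type) (e : T -> T -> Prop)
    (D : set T) (f : I -> T) : Prop :=
  [/\ forall i, D (f i),
      forall i j, e (f i) (f j) -> i = j
    & forall B, D B -> exists i, e (f i) B].

Definition coordinates (R : realType) (m n : nat) (A : 'M[R]_(m, n)) : set R :=
  [set x | exists i j, A i j = x].

Definition occurrences (R : realType) (m n : nat) (x : R) (A : 'M[R]_(m, n)) :
    nat :=
  #|[pred ij : 'I_m * 'I_n | A ij.1 ij.2 == x]|.

Definition symmetric_1K (R : realType) (K : R) : set 'M[R]_3 :=
  [set A | [/\ A^T = A, coordinates A = [set 1; K]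
             & (occurrences K A <= 4)%N]].

Definition mx3 (R : realType) (s : seq (seq R)) : 'M[R]_3 :=
  \matrix_(i, j) nth 0 (nth [::] s i) j.

Definition A1 (R : realType) (K : R) : 'M[R]_3 :=
  mx3 [:: [:: K; 1; 1];
          [:: 1; K; 1];
          [:: 1; 1; K]].

Definition A2 (R : realType) (K : R) : 'M[R]_3 :=
  mx3 [:: [:: K; 1; 1];
          [:: 1; 1; 1];
          [:: 1; 1; 1]].

Definition A3 (R : realType) (K : R) : 'M[R]_3 :=
  mx3 [:: [:: 1; 1; 1];
          [:: 1; K; K];
          [:: 1; K; K]].

Definition A4 (R : realType) (K : R) : 'M[R]_3 :=
  mx3 [:: [:: 1; K; K];
          [:: K; 1; 1];
          [:: K; 1; 1]].

Definition A5 (R : realType) (K : R) : 'M[R]_3 :=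
  mx3 [:: [:: K; 1; 1];
          [:: 1; K; 1];
          [:: 1; 1; 1]].

Definition A6 (R : realType) (K : R) : 'M[R]_3 :=
  mx3 [:: [:: K; K; 1];
          [:: K; 1; 1];
          [:: 1; 1; 1]].

Definition A7 (R : realType) (K : R) : 'M[R]_3 :=
  mx3 [:: [:: K; K; 1];
          [:: K; 1; 1];
          [:: 1; 1; K]].

Lemma positive_diagonalP (R : realType) (n : nat) (X : 'M[R]_n) :
  positive_diagonal X <->
  exists2 d : 'rV[R]_n, X = diag_mx d & forall i, 0 < d 0 i.
Proof.
split=> [[/is_diag_mxP dX X0]|[d -> d0]].
  exists (\row_i X i i) => [|i]; last by rewrite mxE.
  apply/matrixP => i j; rewrite !mxE; case: eqVneq => [->|ij] //.
  by rewrite mulr0n dX.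
split; first by apply/is_diag_mxP => i j ij; rewrite mxE -val_eqE (negPf ij) mulr0n.
by move=> i; rewrite mxE eqxx mulr1n.
Qed.

Lemma sinkhorn_scalingP (R : realType) (n : nat) (A S : 'M[R]_n) :
  sinkhorn_scaling A S <-> doubly_stochastic S /\
  exists x y : 'I_n -> R, [/\ forall i, 0 < x i, forall i, 0 < y i
     & forall i j, S i j = x i * A i j * y j].
Proof.
split=> -[dS [x [y [hx hy e]]]]; split=> //.
  have [d dE d0] := (positive_diagonalP _).1 hx.
  have [d' dE' d0'] := (positive_diagonalP _).1 hy.
  exists (d 0), (d' 0); split=> // i j.
  by rewrite e dE dE' mul_mx_diag mxE mul_diag_mx mxE.
exists (diag_mx (\row_i x i)), (diag_mx (\row_i y i)); split.
- by apply/positive_diagonalP; eexists => // i; rewrite mxE.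
- by apply/positive_diagonalP; eexists => // i; rewrite mxE.
by apply/matrixP => i j; rewrite e mul_mx_diag mxE mul_diag_mx !mxE.
Qed.

Lemma sinkhorn_scaling_unique (R : realType) (n : nat) (A S T : 'M[R]_n) :
  positive_mx A -> sinkhorn_scaling A S -> sinkhorn_scaling A T -> S = T.
Proof.
move=> A0 /sinkhorn_scalingP[[_ Sr Sc] [x [y [x0 y0 SE]]]].
move=> /sinkhorn_scalingP[[_ Tr Tc] [u [v [u0 v0 TE]]]].
case: n A S T A0 Sr Sc x y x0 y0 SE Tr Tc u v u0 v0 TE => [|n] A S T A0 Sr Sc
  x y x0 y0 SE Tr Tc u v u0 v0 TE; first by apply/matrixP => -[].
have S0 i j : 0 < S i j by rewrite SE !mulr_gt0.
pose d i := u i / x i; pose e j := v j / y j.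
have TS i j : T i j = d i * S i j * e j.
  rewrite TE SE /d /e; have := x0 i; have := y0 j; move=> /gt_eqF y0' /gt_eqF x0'.
  by field; rewrite x0' y0'.
have d0 i : 0 < d i by rewrite divr_gt0.
have e0 i : 0 < e i by rewrite divr_gt0.
have re i : \sum_j S i j * e j = (d i)^-1.
  apply: (mulfI (lt0r_neq0 (d0 i))); rewrite mulfV ?lt0r_neq0// -(Tr i) mulr_sumr.
  by apply: eq_bigr => j _; rewrite TS mulrA.
have ce j : \sum_i d i * S i j = (e j)^-1.
  apply: (mulIf (lt0r_neq0 (e0 j))); rewrite mulVf ?lt0r_neq0// -(Tc j) mulr_suml.
  by apply: eq_bigr => i _; rewrite TS.
have [p hp] : exists p, forall i, d i <= d p.
  case: (@arg_maxP _ R _ (ord0 : 'I_n.+1) xpredT d isT) => p _ hp.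
  by exists p => i; exact: hp.
have el j : (d p)^-1 <= e j.
  rewrite -[e j]invrK lef_pV2 ?posrE ?invr_gt0//.
  rewrite -ce -[leRHS]mulr1 -(Sc j) mulr_sumr ler_sum// => i _.
  by rewrite ler_wpM2r// ltW.
have ee j : e j = (d p)^-1.
  have H : \sum_j S p j * (e j - (d p)^-1) = 0.
    under eq_bigr do rewrite mulrBr.
    by rewrite sumrB re -mulr_suml Sr mul1r subrr.
  have /eqP := H; rewrite psumr_eq0; last first.
    by move=> k _; rewrite mulr_ge0 ?subr_ge0// ltW.
  move=> /allP/(_ j (mem_index_enum _))/=.
  by rewrite mulf_eq0 gt_eqF//= subr_eq0 => /eqP.
have dd i : d i = d p.
  apply: invr_inj; rewrite -re; under eq_bigr do rewrite ee.
  by rewrite -mulr_suml Sr mul1r.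
apply/matrixP => i j; rewrite TS dd ee mulrAC mulfV ?mul1r//.
exact: lt0r_neq0.
Qed.

Lemma prod_le1_of_sum (R : realType) (n : nat) (E : 'I_n.+1 -> R) :
  (forall i, 0 <= E i) -> \sum_i E i = n.+1%:R ->
  \prod_i E i <= 1 /\ (\prod_i E i = 1 -> forall i, E i = 1).
Proof.
move=> E0 sE; have := @leif_AGM R _ 'I_n.+1 E (fun i _ => E0 i).
rewrite [#|_|]card_ord (_ : \sum_(i in 'I_n.+1) E i = n.+1%:R); last first.
  by rewrite -sE; apply: eq_bigl.
rewrite divff ?pnatr_eq0// expr1n.
rewrite (eq_bigl xpredT) => [[le1 eq1]|i]; last by [].
split=> // /eqP; rewrite eq1 => /forall_inP h i.
have hi j : E j = E i by have /forall_inP/(_ i isT)/eqP := h j isT.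
move: sE; rewrite (eq_bigr (fun=> E i)) => [|j _]; last exact: hi.
rewrite sumr_const card_ord -[LHS]mulr_natr => /(canRL (mulfK _)) ->.
  by rewrite divff ?pnatr_eq0.
by rewrite pnatr_eq0.
Qed.

Lemma sinkhorn_scaling_exists (R : realType) (n : nat) (A : 'M[R]_n) :
  positive_mx A -> exists S, sinkhorn_scaling A S.
Proof.
case: n A => [|n] A A0.
  exists 0; apply/sinkhorn_scalingP; split; first by split=> -[].
  by exists (fun=> 1), (fun=> 1); split=> -[].
pose M := \sum_i \sum_j A i j.
pose m := (\sum_i \sum_j (A i j)^-1)^-1.
have AM i j : A i j <= M.
  rewrite /M (bigD1 i)//= (bigD1 j)//= -addrA lerDl addr_ge0//.
    by apply: sumr_ge0 => k _; exact: ltW.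
  by apply: sumr_ge0 => k _; apply: sumr_ge0 => l _; exact: ltW.
have Am' i j : (A i j)^-1 <= m^-1.
  rewrite /m invrK (bigD1 i)//= (bigD1 j)//= -addrA lerDl addr_ge0//.
    by apply: sumr_ge0 => k _; rewrite invr_ge0 ltW.
  by apply: sumr_ge0 => k _; apply: sumr_ge0 => l _; rewrite invr_ge0 ltW.
have m0 : 0 < m.
  by rewrite -invr_gt0 (lt_le_trans _ (Am' ord0 ord0))// invr_gt0.
have Am i j : m <= A i j by have := Am' i j; rewrite lef_pV2 ?posrE.
have M0 : 0 < M by exact: lt_le_trans (A0 ord0 ord0) (AM _ _).
pose N : R := n.+1%:R.
have N0 : 0 < N by rewrite ltr0n.
pose c := m ^+ 2 / M ^+ 2.
have c0 : 0 < c by rewrite divr_gt0 ?exprn_gt0.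
have mM : m <= M by exact: le_trans (Am ord0 ord0) (AM _ _).
have c1 : c <= 1.
  by rewrite ler_pdivrMr ?exprn_gt0// mul1r ler_pXn2r// ?nnegrE ltW.
pose row (x : 'rV[R]_n.+1) i := \sum_j A i j * x 0 j.
pose phi (x : 'rV[R]_n.+1) := \prod_j (x 0 j / row x j).
pose box := [set x : 'rV[R]_n.+1 | forall j, `[c, 1]%classic (x 0 j)].
have box0 x j : box x -> 0 < x 0 j.
  by move=> /(_ j); rewrite /= in_itv/= => /andP[cx _]; exact: lt_le_trans cx.
have row0 (x : 'rV[R]_n.+1) i : (forall j, 0 < x 0 j) -> 0 < row x i.
  move=> x0; rewrite /row (bigD1 i)//= ltr_pwDl ?mulr_gt0// sumr_ge0// => k _.
  by rewrite ltW ?mulr_gt0.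
have rowZ (l : R) x i : row (l *: x) i = l * row x i.
  by rewrite /row mulr_sumr; apply: eq_bigr => j _; rewrite mxE mulrCA.
have phiZ (l : R) x : l != 0 -> phi (l *: x) = phi x.
  move=> l0; apply: eq_bigr => j _; rewrite rowZ mxE invfM mulrACA mulfV//.
  by rewrite mul1r.
have [x bx xmax] : exists2 x, box x & forall y, box y -> phi y <= phi x.
  have [|||x] := @EVT_max_rV R n.+1 phi box.
  - by exists (const_mx 1) => j /=; rewrite mxE in_itv/= c1 lexx.
  - apply: (@rV_compact R n.+1 (fun=> `[c, 1]%classic)) => i.
    exact: segment_compact.
  - apply: continuous_in_subspaceT => x /set_mem bx.
    apply: (@cvg_big R _ *%R 1 xpredT mul_continuous _ (nbhs x) _ _ _ _) => i _.
    apply: cvgM; first exact: coord_continuous.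
    apply: cvgV; first by rewrite gt_eqF// row0// => j; exact: box0.
    apply: (@cvg_big R _ +%R 0 xpredT add_continuous _ (nbhs x) _ _ _ _) => k _; apply: cvgM; first exact: cvg_cst.
    exact: coord_continuous.
  by rewrite inE => bx mx; exists x => // y by'; apply: mx; rewrite inE.
have x0 j : 0 < x 0 j by exact: box0.
have rx i : 0 < row x i by exact: row0.
pose s := \sum_j x 0 j.
have s0 : 0 < s.
  by rewrite /s (bigD1 ord0)//= ltr_pwDl// sumr_ge0// => i _; exact: ltW.
have rm i : m * s <= row x i.
  by rewrite mulr_sumr ler_sum// => j _; rewrite ler_wpM2r// ltW.
have rM i : row x i <= M * s.
  by rewrite mulr_sumr ler_sum// => j _; rewrite ler_wpM2r// ltW.
pose B i j := A i j * x 0 j / row x i.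
have B0 i j : 0 < B i j by rewrite divr_gt0 ?mulr_gt0.
have Br i : \sum_j B i j = 1.
  by rewrite /B -mulr_suml; apply: (@mulfV _ (row x i)); rewrite gt_eqF.
pose C j := \sum_i B i j.
have C0 j : 0 < C j.
  by rewrite /C (bigD1 j)//= ltr_pwDl// sumr_ge0// => i _; exact: ltW.
pose x' : 'rV[R]_n.+1 := \row_j (x 0 j / C j).
have x'0 j : 0 < x' 0 j by rewrite mxE divr_gt0.
pose D j := \sum_i A i j / row x i.
have CE j : C j = x 0 j * D j.
  by rewrite /D mulr_sumr; apply: eq_bigr => i _; rewrite /B mulrCA mulrA.
have D0 j : 0 < D j.
  by have := C0 j; rewrite CE pmulr_rgt0.
have x'E j : x' 0 j = (D j)^-1.
  by rewrite mxE CE invfM mulrA mulfV ?mul1r// gt_eqF.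
have sumN (u : R) : \sum_(i < n.+1) u = N * u.
  by rewrite sumr_const card_ord mulr_natl.
have DM j : D j <= N * (M / (m * s)).
  rewrite -sumN ler_sum// => i _.
  by rewrite ler_pM ?invr_ge0 ?(ltW (rx i)) ?(ltW (A0 i j))// lef_pV2 ?posrE ?mulr_gt0.
have Dm j : N * (m / (M * s)) <= D j.
  rewrite -sumN ler_sum// => i _.
  apply: ler_pM => //; first exact: ltW.
    by rewrite invr_ge0 mulr_ge0// ltW.
  by rewrite lef_pV2 ?posrE ?mulr_gt0.
pose l := N * (m / (M * s)).
have l0 : 0 < l by rewrite mulr_gt0// divr_gt0// mulr_gt0.
have bx' : box (l *: x').
  move=> j /=; rewrite in_itv/= mxE x'E ler_pdivlMr// ler_pdivrMr// mul1r Dm.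
  rewrite andbT; apply: le_trans (ler_wpM2l (ltW c0) (DM j)) _.
  rewrite le_eqVlt; apply/orP; left; apply/eqP; rewrite /c /l; field.
  by rewrite !gt_eqF.
have sB : \sum_i \sum_j B i j / C j = N.
  rewrite exchange_big/= -[RHS]mulr1 -sumN; apply: eq_bigr => j _.
  by rewrite -mulr_suml; apply: (@mulfV _ (C j)); rewrite gt_eqF.
have agm1 : \prod_i (\sum_j B i j / C j) <= 1.
  apply: (prod_le1_of_sum _ sB).1 => i; apply: sumr_ge0 => j _.
  by rewrite divr_ge0 ?ltW.
have sC : \sum_j C j = N.
  rewrite exchange_big/= -[RHS]mulr1 -sumN; apply: eq_bigr => i _; exact: Br.
have [agm2 eqC] := prod_le1_of_sum (fun j => ltW (C0 j)) sC.
have phix' : phi x' * \prod_i (\sum_j B i j / C j) * \prod_j C j = phi x.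
  rewrite -!big_split/=; apply: eq_bigr => i _.
  have -> : \sum_j B i j / C j = row x' i / row x i.
    rewrite mulr_suml; apply: eq_bigr => j _; rewrite /B mxE.
    by rewrite -!mulrA; congr (_ * (_ * _)); rewrite mulrC.
  rewrite mxE; field.
  by rewrite !gt_eqF ?row0.
have phi'0 : 0 < phi x' by apply: prodr_gt0 => i _; rewrite divr_gt0 ?row0.
have pC1 : \prod_j C j = 1.
  apply/eqP; rewrite eq_le agm2/=.
  rewrite -(ler_pM2l phi'0) mulr1.
  have /= := xmax _ bx'; rewrite phiZ ?gt_eqF// => /le_trans; apply.
  rewrite -phix' ler_wpM2r ?prodr_ge0// => [j _|]; first exact: ltW.
  by rewrite -[leRHS]mulr1 ler_wpM2l// ltW.
exists (\matrix_(i, j) B i j); apply/sinkhorn_scalingP; split.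
  split=> [i j|i|j].
  - by rewrite mxE ltW.
  - by rewrite -[RHS](Br i); apply: eq_bigr => j _; rewrite mxE.
  - by rewrite -[RHS](eqC pC1 j); apply: eq_bigr => i _; rewrite mxE.
exists (fun i => (row x i)^-1), (fun j => x 0 j); split=> [i|//|i j].
  by rewrite invr_gt0.
by rewrite mxE /B mulrC mulrA.
Qed.

Lemma sinkhornP (R : realType) (n : nat) (A S : 'M[R]_n) :
  positive_mx A -> sinkhorn_scaling A S <-> sinkhorn A = S.
Proof.
move=> A0; split=> [AS|<-]; last first.
  by apply: xgetPex; exact: sinkhorn_scaling_exists.
apply: xget_unique => // T AT; exact: sinkhorn_scaling_unique AT AS.
Qed.

(* Main.v *)
Require Import Defs.
From HB Require Import structures.
From mathcomp Require Import all_boot all_order all_algebra all_fingroup.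
From mathcomp Require Import all_classical all_reals all_analysis.
From mathcomp Require Import ring lra.

Set Implicit Arguments.
Unset Strict Implicit.
Unset Printing Implicit Defensive.

Import Order.TTheory GRing.Theory Num.Theory.

Local Open Scope classical_set_scope.
Local Open Scope ring_scope.

(** The classification is a finite question about patterns of booleans. If
    [A ~ B] and both have coordinate set [{1, K}], then multiplication by the
    scalar [l] maps [{1, K}] into [{1, K}]. Since [K != 1] and [K > 0], this
    forces [l = 1]: otherwise [l = K] and [K ^+ 2] is [1] or [K]. So [A] and
    [B] differ by a permutation of rows and one of columns, which can be read
    on the positions of [K] alone ([sim_pattern_sound],
    [sim_pattern_complete]). A symmetric pattern has six free bits; running
    over the 64 patterns and the 36 pairs of permutations settles that the
    seven representatives are pairwise inequivalent and meet every class.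

    For the limits, a positive matrix [S] is of the form [X A Y] exactly when
    the cross-ratios [S i j * S 0 0 / (S i 0 * S 0 j)] agree with those of [A],
    because these are the invariants of row and column scaling. By uniqueness
    of the Sinkhorn limit, [sinkhorn A] is thus the positive doubly stochastic
    matrix with the cross-ratios of [A] ([sinkhorn_eq_of_cross_ratios]). For a
    symmetric 3 x 3 matrix this leaves three row sums and three cross-ratios
    to verify ([sinkhorn_sym3]). Apart from the first, the closed forms are
    quotients whose numerator and denominator both vanish at [K = 1]; rewritten
    in the radical [s] (or in the cube root [t] of [K]) they become simple
    fractions such as [(s - 1) / (s + 3)], whose positivity is plain for [K] on
    either side of [1] and whose identities are rational. The shape of the last limit only expresses that the limit of a
    symmetric matrix is symmetric ([trmx_sinkhorn]). *)

(** * Patterns of the coordinates 1 and K *)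

Definition pattern_mx (R : realType) (K : R) (m : seq (seq bool)) : 'M[R]_3 :=
  mx3 [seq [seq if b then K else 1 | b <- r] | r <- m].

Definition wf_pattern (m : seq (seq bool)) : bool :=
  (size m == 3%N) && all (fun r => size r == 3%N) m.

Lemma pattern_mxE (R : realType) (K : R) m i j : wf_pattern m ->
  pattern_mx K m i j = if nth false (nth [::] m i) j then K else 1.
Proof.
move=> /andP[/eqP sm /allP am].
have ltm : (i < size m)%N by rewrite sm.
have /eqP sr := am _ (mem_nth [::] ltm).
by rewrite mxE (nth_map [::])// (nth_map false)// sr.
Qed.

(** Permutations are lists of numbers here, not elements of ['S_3], so that the
    test evaluates by mere computation. *)
Definition sim_pattern (m m' : seq (seq bool)) : bool :=
  has (fun p => has (fun q =>
    all (fun i => all (fun j =>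
      nth false (nth [::] m' i) j
        == nth false (nth [::] m (nth 0%N p i)) (nth 0%N q j))
      (iota 0 3)) (iota 0 3))
    (permutations (iota 0 3))) (permutations (iota 0 3)).

Lemma perm_of_seq n (p : seq nat) : p \in permutations (iota 0 n) ->
  exists s : 'S_n, forall i, s i = nth 0%N p i :> nat.
Proof.
rewrite mem_permutations => pP.
have sp : size p = n by rewrite (perm_size pP) size_iota.
have up : uniq p by rewrite (perm_uniq pP) iota_uniq.
have ltp (i : 'I_n) : (nth 0%N p i < n)%N.
  have : nth 0%N p i \in p by rewrite mem_nth// sp.
  by rewrite (perm_mem pP) mem_iota.
have inj : injective (fun i => Ordinal (ltp i)).
  by move=> i j [] /eqP; rewrite nth_uniq ?sp// => /eqP/val_inj.
by exists (perm inj) => i; rewrite permE.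
Qed.

Lemma seq_of_perm n (s : 'S_n) : exists2 p : seq nat,
  p \in permutations (iota 0 n) & forall i, s i = nth 0%N p i :> nat.
Proof.
exists [seq val (s i) | i <- enum 'I_n]; last first.
  by move=> i; rewrite (nth_map i) ?size_enum_ord// nth_ord_enum.
rewrite mem_permutations -val_enum_ord (map_comp val s).
apply/perm_map/uniq_perm => [||i].
- by rewrite map_inj_uniq ?enum_uniq//; exact: perm_inj.
- exact: enum_uniq.
rewrite mem_enum; apply/mapP.
by exists ((s^-1)%g i); rewrite ?mem_enum// permKV.
Qed.

Lemma perm_mx_scale_entry (R : realType) n (s t : 'S_n) (l : R) (A : 'M[R]_n)
    i j :
  (l *: (perm_mx s *m A *m perm_mx t)) i j = l * A (s i) ((t^-1)%g j).
Proof. by rewrite mxE -row_permE -[t]invgK -col_permE !mxE invgK. Qed.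

Lemma sim_pattern_sound (R : realType) (K : R) m m' :
  wf_pattern m -> wf_pattern m' ->
  sim_pattern m m' -> mx_sim (pattern_mx K m) (pattern_mx K m').
Proof.
move=> wm wm' /hasP[p /perm_of_seq[s sE]] /hasP[q /perm_of_seq[t tE]] /allP mm'.
exists (perm_mx s), (perm_mx t^-1), 1; split=> //; try exact: perm_mx_is_perm.
apply/matrixP => i j; rewrite perm_mx_scale_entry invgK mul1r !pattern_mxE// sE tE.
have ord_iota (k : 'I_3) : val k \in iota 0 3 by rewrite mem_iota ltn_ord.
by have /allP/(_ _ (ord_iota j))/eqP -> := mm' _ (ord_iota i).
Qed.

(** The hypothesis that both values occur in the first matrix is what excludes a
    rescaling: the constant matrices [1] and [K] are equivalent, though their
    patterns are not. *)
Lemma sim_pattern_complete (R : realType) (K : R) m m' :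
  0 < K -> K != 1 -> wf_pattern m -> wf_pattern m' ->
  coordinates (pattern_mx K m) = [set 1; K] ->
  mx_sim (pattern_mx K m) (pattern_mx K m') -> sim_pattern m m'.
Proof.
move=> K0 K1 wm wm' mE [_ [_ [l [/is_perm_mxP[s ->] /is_perm_mxP[t ->] l0 BE]]]].
have entry i j : pattern_mx K m' i j = l * pattern_mx K m (s i) ((t^-1)%g j).
  by rewrite BE perm_mx_scale_entry.
have scaled x : coordinates (pattern_mx K m) x -> l * x = 1 \/ l * x = K.
  move=> [i [j <-]]; have := entry ((s^-1)%g i) (t j).
  by rewrite permKV permK pattern_mxE// => <-; case: ifP; [right|left].
(* Scaling 1 gives l = 1 or l = K; in the second case K * K is 1 or K. *)
have l1 : l = 1.
  have [] := scaled 1; rewrite ?mE ?mulr1; [by left|by []|move=> lK].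
  have [] := scaled K; rewrite ?mE ?lK; [by right| |].
    by move=> /eqP; rewrite -expr2 sqrp_eq1 ?(ltW K0)// (negPf K1).
  by rewrite -[RHS]mulr1 => /(mulfI (lt0r_neq0 K0)) /eqP; rewrite (negPf K1).
have [p pP sE] := seq_of_perm s; have [q qP tE] := seq_of_perm (t^-1)%g.
apply/hasP; exists p => //; apply/hasP; exists q => //.
apply/allP => i; rewrite mem_iota => /andP[_ lti].
apply/allP => j; rewrite mem_iota => /andP[_ ltj].
have := entry (Ordinal lti) (Ordinal ltj).
rewrite l1 mul1r !pattern_mxE// sE tE/=.
by do 2 case: nth => //; move=> /eqP; rewrite ?(negPf K1)// eq_sym (negPf K1).
Qed.

(** * The seven classes *)

Definition symmetric_pattern (a b c d e f : bool) : seq (seq bool) :=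
  [:: [:: a; b; c]; [:: b; d; e]; [:: c; e; f]].

Definition representatives : seq (seq (seq bool)) :=
  [:: symmetric_pattern true false false true false true;
      symmetric_pattern true false false false false false;
      symmetric_pattern false false false true true true;
      symmetric_pattern false true true false false false;
      symmetric_pattern true false false true false false;
      symmetric_pattern true true false false false false;
      symmetric_pattern true true false false false true].

Lemma tnth_representatives (R : realType) (K : R) (i : 'I_7) :
  tnth [tuple A1 K; A2 K; A3 K; A4 K; A5 K; A6 K; A7 K] i
    = pattern_mx K (nth [::] representatives i).
Proof. by case: i => [[|[|[|[|[|[|[|//]]]]]]] ?]. Qed.

Definition few_true (m : seq (seq bool)) : bool :=
  (true \in flatten m) && (false \in flatten m) && (count id (flatten m) <= 4)%N.

Lemma representatives_inequivalent :
  all (fun i => all (fun j =>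
      sim_pattern (nth [::] representatives i) (nth [::] representatives j)
        ==> (i == j)) (iota 0 7)) (iota 0 7).
Proof. by vm_compute. Qed.

Lemma representatives_exhaustive a b c d e f :
  few_true (symmetric_pattern a b c d e f) ->
  has (fun r => sim_pattern r (symmetric_pattern a b c d e f)) representatives.
Proof. by move: a b c d e f; do 6 case; vm_compute. Qed.

Lemma occurrences_pattern_mx (R : realType) (K : R) a b c d e f : K != 1 ->
  occurrences K (pattern_mx K (symmetric_pattern a b c d e f))
    = count id (flatten (symmetric_pattern a b c d e f)).
Proof.
move=> K1; rewrite /occurrences -sum1_card big_mkcond/=.
rewrite -(pair_bigA _ (fun i j =>
  if pattern_mx K (symmetric_pattern a b c d e f) i j == K then 1 else 0)%N)/=.
have inK x : ((if x then K else 1) == K) = x.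
  by case: x; rewrite ?eqxx// eq_sym (negPf K1).
under eq_bigr do under eq_bigr do rewrite pattern_mxE// inK.
by rewrite !big_ord_recl !big_ord0/= !addn0 !addnA.
Qed.

Lemma coordinates_pattern_mx (R : realType) (K : R) m : wf_pattern m ->
  coordinates (pattern_mx K m) = [set if b then K else 1 | b in [set` flatten m]].
Proof.
move=> wm; have /andP[/eqP sm /allP am] := wm.
have sr r : r \in m -> size r = 3%N by move=> /am/eqP.
apply/seteqP; split=> x /=.
  move=> [i [j <-]]; rewrite pattern_mxE//.
  exists (nth false (nth [::] m i) j) => //.
  have mi : nth [::] m i \in m by rewrite mem_nth// sm.
  by apply/flattenP; exists (nth [::] m i) => //; rewrite mem_nth// sr.
move=> [b /flattenP[r mr rb] <-].
have ltr : (index r m < 3)%N by rewrite -sm index_mem.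
have ltb : (index b r < 3)%N by rewrite -(sr r mr) index_mem.
by exists (Ordinal ltr), (Ordinal ltb); rewrite pattern_mxE//= !nth_index.
Qed.

Lemma symmetric_1K_pattern (R : realType) (K : R) a b c d e f : K != 1 ->
  symmetric_1K K (pattern_mx K (symmetric_pattern a b c d e f))
    <-> few_true (symmetric_pattern a b c d e f).
Proof.
move=> K1; rewrite /few_true -(occurrences_pattern_mx _ _ _ _ _ _ K1).
set m := symmetric_pattern a b c d e f.
have mE := @coordinates_pattern_mx R K m isT.
split=> [[_ cE ->]|/andP[/andP[tm fm] le4]].
  rewrite andbT; move: mE; rewrite cE => mE.
  have : [set 1; K] K by right.
  have : [set 1; K] 1 by left.
  rewrite mE => -[[]/= mx E1] [[]/= my E2]; move: K1.
  - by rewrite E1 eqxx.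
  - by rewrite E1 eqxx.
  - by rewrite mx my.
  - by rewrite E2 eqxx.
split=> //.
  by apply/matrixP => -[[|[|[|//]]] ?] [[|[|[|//]]] ?]; rewrite !mxE.
rewrite mE; apply/seteqP; split=> x /=.
  by move=> [[] _ <-]; [right|left].
by move=> [->|->]; [exists false|exists true].
Qed.

(** A matrix with entries in [{1, K}] is recovered from the positions of [K], and
    by symmetry from those on and above the diagonal. *)
Lemma symmetric_1K_is_pattern (R : realType) (K : R) (B : 'M[R]_3) :
  symmetric_1K K B -> exists a b c d e f,
    B = pattern_mx K (symmetric_pattern a b c d e f).
Proof.
move=> [symB cB _].
have entry i j : B i j = if B i j == K then K else 1.
  have : coordinates B (B i j) by exists i, j.
  by rewrite cB => -[->|->]; [case: eqP|rewrite eqxx].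
have sB i j : B i j = B j i by rewrite -[in LHS]symB mxE.
pose k i j := B (inord i) (inord j) == K.
exists (k 0 0)%N, (k 0 1)%N, (k 0 2)%N, (k 1 1)%N, (k 1 2)%N, (k 2 2)%N.
apply/matrixP => i j; rewrite pattern_mxE//.
have kE : k i j = (B i j == K) by rewrite /k !inord_val.
have kS i' j' : k i' j' = k j' i' by rewrite /k sB.
rewrite entry -kE; case: i j {kE} => [[|[|[|//]]] ?] [[|[|[|//]]] ?] //=;
  by rewrite kS.
Qed.

Lemma classification (R : realType) (K : R) : 0 < K -> K != 1 ->
  complete_representatives (@mx_sim R 3) (symmetric_1K K)
    (tnth [tuple A1 K; A2 K; A3 K; A4 K; A5 K; A6 K; A7 K]).
Proof.
move=> K0 K1.
have in1K i : symmetric_1K K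
    (tnth [tuple A1 K; A2 K; A3 K; A4 K; A5 K; A6 K; A7 K] i).
  rewrite tnth_representatives.
  by case: i => [[|[|[|[|[|[|[|//]]]]]]] ?]; apply/symmetric_1K_pattern.
have wf_repr (i : 'I_7) : wf_pattern (nth [::] representatives i).
  by case: i => [[|[|[|[|[|[|[|//]]]]]]] ?].
split=> // [i j|B].
  have [_ ci _] := in1K i; move: ci; rewrite !tnth_representatives => ci.
  move=> /(sim_pattern_complete K0 K1 (wf_repr i) (wf_repr j) ci) ij.
  have ord_iota (k : 'I_7) : val k \in iota 0 7 by rewrite mem_iota ltn_ord.
  have /allP/(_ _ (ord_iota i))/allP/(_ _ (ord_iota j)) :=
    representatives_inequivalent.
  by rewrite ij => /eqP/val_inj.
move=> DB; have [a [b [c [d [e [f BE]]]]]] := symmetric_1K_is_pattern DB.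
move: DB; rewrite BE => /(symmetric_1K_pattern _ _ _ _ _ _ K1).
move=> /representatives_exhaustive/(has_nthP [::])[i lti iB].
exists (Ordinal lti); rewrite tnth_representatives.
exact: (sim_pattern_sound K (wf_repr (Ordinal lti)) _ iB).
Qed.

(** * Sinkhorn limits from cross-ratios *)

(** Normalising the row and column of index [0] determines the scaling: the row
    factors [S i 0 / A i 0] match column [0], then the column factors match row
    [0], and agreement of the cross-ratios propagates the match to all other
    entries. *)
Lemma sinkhorn_eq_of_cross_ratios (R : realType) n (A S : 'M[R]_n.+1) :
  positive_mx A -> positive_mx S ->
  (forall i, \sum_j S i j = 1) -> (forall j, \sum_i S i j = 1) ->
  (forall i j, S i j * S 0 0 * (A i 0 * A 0 j)
             = S i 0 * S 0 j * (A i j * A 0 0)) ->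
  sinkhorn A = S.
Proof.
move=> A0 S0 rS cS cross; apply/sinkhornP => //; apply/sinkhorn_scalingP.
split; first by split=> // i j; exact: ltW.
exists (fun i => S i 0 / A i 0), (fun j => S 0 j / A 0 j * (A 0 0 / S 0 0)).
split=> [i|j|i j]; [by rewrite divr_gt0|by rewrite mulr_gt0// divr_gt0|].
have Ai0 := A0 i 0; have A0j := A0 0 j; have S00 := S0 0 0.
have nz : S 0 0 * (A i 0 * A 0 j) != 0 by rewrite !mulf_neq0// gt_eqF.
have := cross i j; rewrite -mulrA => /(canRL (mulfK nz)) ->; field.
by rewrite !gt_eqF.
Qed.

Lemma sinkhorn_sym3 (R : realType) (p q r s t u a b c d e f : R) :
  0 < p -> 0 < q -> 0 < r -> 0 < s -> 0 < t -> 0 < u ->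
  0 < a -> 0 < b -> 0 < c -> 0 < d -> 0 < e -> 0 < f ->
  a + b + c = 1 -> b + d + e = 1 -> c + e + f = 1 ->
  a * d * q ^+ 2 = b ^+ 2 * (p * s) ->
  a * e * (q * r) = b * c * (p * t) ->
  a * f * r ^+ 2 = c ^+ 2 * (p * u) ->
  sinkhorn (mx3 [:: [:: p; q; r]; [:: q; s; t]; [:: r; t; u]]) =
  mx3 [:: [:: a; b; c]; [:: b; d; e]; [:: c; e; f]].
Proof.
move=> p0 q0 r0 s0 t0 u0 a0 b0 c0 d0 e0 f0 sum1 sum2 sum3 cr11 cr12 cr22.
apply: sinkhorn_eq_of_cross_ratios.
- by case=> [[|[|[|//]]] ?] [[|[|[|//]]] ?]; rewrite !mxE.
- by case=> [[|[|[|//]]] ?] [[|[|[|//]]] ?]; rewrite !mxE.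
- by case=> [[|[|[|//]]] ?]; rewrite !big_ord_recl big_ord0 !mxE/= addr0 addrA.
- by case=> [[|[|[|//]]] ?]; rewrite !big_ord_recl big_ord0 !mxE/= addr0 addrA.
by case=> [[|[|[|//]]] ?] [[|[|[|//]]] ?]; rewrite !mxE/=;
  first [ring | ring: cr11 | ring: cr12 | ring: cr22].
Qed.

(** If [S = X A Y] then [S^T = Y A^T X = Y A X] is again a doubly stochastic
    scaling of [A], so uniqueness identifies it with [S]. *)
Lemma trmx_sinkhorn (R : realType) n (A : 'M[R]_n) :
  positive_mx A -> A^T = A -> (sinkhorn A)^T = sinkhorn A.
Proof.
move=> A0 sA; symmetry; apply/sinkhornP => //.
have /sinkhorn_scalingP[[S0 rS cS] [x [y [x0 y0 SE]]]] :
    sinkhorn_scaling A (sinkhorn A).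
  exact/sinkhornP.
apply/sinkhorn_scalingP; split.
  split=> [i j|i|j]; first by rewrite mxE.
    by rewrite -[RHS](cS i); apply: eq_bigr => j _; rewrite mxE.
  by rewrite -[RHS](rS j); apply: eq_bigr => i _; rewrite mxE.
exists y, x; split=> // i j.
have -> : A i j = A j i by rewrite -[in LHS]sA mxE.
by rewrite mxE SE; ring.
Qed.

(** * The limits of the seven representatives *)

Lemma sinkhorn_A1 (R : realType) (K : R) : 0 < K ->
  let a := K / (K + 2) in
  let b := 1 / (K + 2) in
  sinkhorn (A1 K) = mx3 [:: [:: a; b; b]; [:: b; a; b]; [:: b; b; a]].
Proof.
move=> K0 a b.
have K20 : 0 < K + 2 by lra.
have nz : K + 2 != 0 by rewrite gt_eqF.
by apply: sinkhorn_sym3; rewrite // /a /b ?divr_gt0//; field.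
Qed.

(** In both matrices the only nontrivial cross-ratio is [a * c / b ^+ 2 = K],
    which is why their limits coincide. With [a = 1 - 2 b] and
    [c = (1 - b) / 2] it becomes a quadratic equation in [b], of which
    [2 / (s + 3)] is the root that makes [a], [b] and [c] positive. *)
Lemma sinkhorn_A2_A3 (R : realType) (K s : R) :
  0 < K -> K != 1 -> 0 <= s -> s ^+ 2 = 8 * K + 1 ->
  let a := (2 * K + 1 - s) / (2 * (K - 1)) in
  let b := (- 3 + s) / (4 * (K - 1)) in
  let c := (4 * K - 1 - s) / (8 * (K - 1)) in
  let S := mx3 [:: [:: a; b; b]; [:: b; c; c]; [:: b; c; c]] in
  sinkhorn (A2 K) = S /\ sinkhorn (A3 K) = S.
Proof.
move=> K0 K1 s0 sK.
have s1 : 1 < s by nra.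
have K10 : K - 1 != 0 by rewrite subr_eq0.
have s3 : s + 3 != 0 by rewrite gt_eqF//; lra.
have -> /= : (2 * K + 1 - s) / (2 * (K - 1)) = (s - 1) / (s + 3).
  by apply/eqP; rewrite eqr_div ?mulf_neq0//; apply/eqP; ring: sK.
have -> : (- 3 + s) / (4 * (K - 1)) = 2 / (s + 3).
  by apply/eqP; rewrite eqr_div ?mulf_neq0//; apply/eqP; ring: sK.
have -> : (4 * K - 1 - s) / (8 * (K - 1)) = (s + 1) / (2 * (s + 3)).
  by apply/eqP; rewrite eqr_div ?mulf_neq0//; apply/eqP; ring: sK.
have KE : K = (s ^+ 2 - 1) / 8 by rewrite sK; field.
have a0 : 0 < (s - 1) / (s + 3) by rewrite divr_gt0//; lra.
have b0 : 0 < 2 / (s + 3) by rewrite divr_gt0//; lra.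
have c0 : 0 < (s + 1) / (2 * (s + 3)) by rewrite divr_gt0//; lra.
by split; apply: sinkhorn_sym3 => //; rewrite ?KE; field.
Qed.

(** Here the cross-ratio is [a * c / b ^+ 2 = K ^- 2]. In terms of [s], [a * c] has
    the numerator [(s - K) * (s + K) = 8], whence the equality. *)
Lemma sinkhorn_A4 (R : realType) (K s : R) :
  0 < K -> K != 1 -> 0 <= s -> s ^+ 2 = K ^+ 2 + 8 ->
  let a := (- K ^+ 2 - 2 + K * s) / (2 * (K ^+ 2 - 1)) in
  let b := (3 * K ^+ 2 - K * s) / (4 * (K ^+ 2 - 1)) in
  let c := (K ^+ 2 - 4 + K * s) / (8 * (K ^+ 2 - 1)) in
  sinkhorn (A4 K) = mx3 [:: [:: a; b; b]; [:: b; c; c]; [:: b; c; c]].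
Proof.
move=> K0 K1 s0 sK.
have sgtK : K < s by nra.
have K10 : K ^+ 2 - 1 != 0 by rewrite subr_eq0 sqrp_eq1// ltW.
have d0 : 0 < 3 * K + s by lra.
have nz : 3 * K + s != 0 by rewrite gt_eqF.
have -> /= : (- K ^+ 2 - 2 + K * s) / (2 * (K ^+ 2 - 1)) = (s - K) / (3 * K + s).
  by apply/eqP; rewrite eqr_div ?mulf_neq0//; apply/eqP; ring: sK.
have -> : (3 * K ^+ 2 - K * s) / (4 * (K ^+ 2 - 1)) = 2 * K / (3 * K + s).
  by apply/eqP; rewrite eqr_div ?mulf_neq0//; apply/eqP; ring: sK.
have -> : (K ^+ 2 - 4 + K * s) / (8 * (K ^+ 2 - 1)) = (s + K) / (2 * (3 * K + s)).
  by apply/eqP; rewrite eqr_div ?mulf_neq0//; apply/eqP; ring: sK.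
have a0 : 0 < (s - K) / (3 * K + s) by rewrite divr_gt0//; lra.
have b0 : 0 < 2 * K / (3 * K + s) by rewrite divr_gt0//; lra.
have c0 : 0 < (s + K) / (2 * (3 * K + s)) by rewrite divr_gt0//; lra.
have ac : (s - K) * (s + K) = 8 by ring: sK.
have cross : (s - K) / (3 * K + s) * ((s + K) / (2 * (3 * K + s))) * K ^+ 2
             = (2 * K / (3 * K + s)) ^+ 2.
  have -> : (s - K) / (3 * K + s) * ((s + K) / (2 * (3 * K + s))) * K ^+ 2
    = (s - K) * (s + K) * K ^+ 2 / (2 * (3 * K + s) ^+ 2) by field.
  by rewrite ac; field.
by apply: sinkhorn_sym3; rewrite ?mulr1 -?expr2//; field.
Qed.

(** With [K = (s ^+ 2 - 5) / 4] all entries are rational in [s]. This includes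
    the nested radical of [c]: the expression [2 * K + 7 - 3 * s] is
    [(s - 3) ^+ 2 / 2], and the sign of [s - 3] is that of [K - 1], so the two
    absolute values cancel and [c = 2 / (s + 3)]. *)
Lemma sinkhorn_A5 (R : realType) (K s : R) :
  0 < K -> K != 1 -> 0 <= s -> s ^+ 2 = 4 * K + 5 ->
  let a := K * (2 * K + 1 - s) / (2 * (K ^+ 2 - 1)) in
  let b := (2 * K + 1 - s) / (2 * (K ^+ 2 - 1)) in
  let c := Num.sqrt (2 * K + 7 - 3 * s) / (Num.sqrt 2 * `|K - 1|) in
  let d := (K + 2 - s) / (K - 1) in
  sinkhorn (A5 K) = mx3 [:: [:: a; b; c]; [:: b; a; c]; [:: c; c; d]].
Proof.
move=> K0 K1 s0 sK.
have s1 : 1 < s by nra.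
have K10 : K - 1 != 0 by rewrite subr_eq0.
have K210 : K ^+ 2 - 1 != 0 by rewrite subr_eq0 sqrp_eq1// ltW.
have d0 : 0 < (s + 3) * (s - 1) by rewrite mulr_gt0//; lra.
have nz : (s + 3) * (s - 1) != 0 by rewrite gt_eqF.
have nz3 : s + 3 != 0 by move: nz; rewrite mulf_eq0 negb_or => /andP[].
have nz1 : s - 1 != 0 by move: nz; rewrite mulf_eq0 negb_or => /andP[].
have KE : K = (s ^+ 2 - 5) / 4 by rewrite sK; field.
have bE : (2 * K + 1 - s) / (2 * (K ^+ 2 - 1)) = 4 / ((s + 3) * (s - 1)).
  apply/eqP; rewrite eqr_div ?mulf_neq0//; apply/eqP.
  by rewrite KE; field.
have -> /= : Num.sqrt (2 * K + 7 - 3 * s) / (Num.sqrt 2 * `|K - 1|) = 2 / (s + 3).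
  have s2 : Num.sqrt 2 ^+ 2 = 2 :> R by rewrite sqr_sqrtr.
  have s20 : Num.sqrt 2 != 0 :> R by rewrite gt_eqF// sqrtr_gt0.
  have ns3 : `|s - 3| != 0.
    rewrite normr_eq0 subr_eq0; apply: contra K1 => /eqP s3.
    by apply/eqP; rewrite KE s3; field.
  have -> : 2 * K + 7 - 3 * s = (s - 3) ^+ 2 / 2 by rewrite KE; field.
  have -> : K - 1 = (s - 3) * (s + 3) / 4 by rewrite KE; field.
  rewrite sqrtrM ?sqr_ge0// sqrtr_sqr sqrtrV// !normrM normfV.
  rewrite [`|s + 3|]ger0_norm ?[`|4|]ger0_norm//; last by lra.
  move: s2 s20 ns3; set x := Num.sqrt 2; set y := `|s - 3| => s2 s20 ns3.
  have -> : y / x / (x * (y * (s + 3) / 4)) = 4 / (x ^+ 2 * (s + 3)).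
    by field; rewrite ns3 s20 nz3.
  by rewrite s2; field.
have -> : (K + 2 - s) / (K - 1) = (s - 1) / (s + 3).
  by apply/eqP; rewrite eqr_div ?mulf_neq0//; apply/eqP; ring: sK.
rewrite -mulrA bE.
have b0 : 0 < 4 / ((s + 3) * (s - 1)) by rewrite divr_gt0.
have a0 : 0 < K * (4 / ((s + 3) * (s - 1))) by rewrite mulr_gt0.
have c0 : 0 < 2 / (s + 3) by rewrite divr_gt0//; lra.
have d0' : 0 < (s - 1) / (s + 3) by rewrite divr_gt0//; lra.
by apply: sinkhorn_sym3 => //; rewrite ?KE; field; rewrite ?nz1 ?nz3.
Qed.

(** Since [K - 1 = (t - 1) * (t ^+ 2 + t + 1)], the limit is the matrix with rows
    [(t, t ^+ 2, 1)], [(t ^+ 2, 1, t)], [(1, t, t ^+ 2)] divided by the common row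
    sum. *)
Lemma sinkhorn_A6 (R : realType) (K t : R) : 0 < t -> K != 1 -> t ^+ 3 = K ->
  let a := (t ^+ 2 - t) / (K - 1) in
  let b := (K - t ^+ 2) / (K - 1) in
  let c := (t - 1) / (K - 1) in
  sinkhorn (A6 K) = mx3 [:: [:: a; b; c]; [:: b; c; a]; [:: c; a; b]].
Proof.
move=> t0 K1 KE.
have K10 : K - 1 != 0 by rewrite subr_eq0.
have K0 : 0 < K by rewrite -KE exprn_gt0.
have d0 : 0 < t ^+ 2 + t + 1 by nra.
have nz : t ^+ 2 + t + 1 != 0 by rewrite gt_eqF.
have -> /= : (t ^+ 2 - t) / (K - 1) = t / (t ^+ 2 + t + 1).
  by apply/eqP; rewrite eqr_div//; apply/eqP; rewrite -KE; ring.
have -> : (K - t ^+ 2) / (K - 1) = t ^+ 2 / (t ^+ 2 + t + 1).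
  by apply/eqP; rewrite eqr_div//; apply/eqP; rewrite -KE; ring.
have -> : (t - 1) / (K - 1) = 1 / (t ^+ 2 + t + 1).
  by apply/eqP; rewrite eqr_div//; apply/eqP; rewrite -KE; ring.
have a0 : 0 < t / (t ^+ 2 + t + 1) by rewrite divr_gt0.
have b0 : 0 < t ^+ 2 / (t ^+ 2 + t + 1) by rewrite divr_gt0// exprn_gt0.
have c0 : 0 < 1 / (t ^+ 2 + t + 1) by rewrite divr_gt0.
by apply: sinkhorn_sym3 => //; rewrite -?KE; field.
Qed.

Lemma sinkhorn_A7_symmetric (R : realType) (K : R) : 0 < K ->
  exists a b c d e f : R,
    sinkhorn (A7 K) = mx3 [:: [:: a; b; c]; [:: b; d; e]; [:: c; e; f]].
Proof.
move=> K0; set S := sinkhorn _.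
have A0 : positive_mx (A7 K).
  by case=> [[|[|[|//]]] ?] [[|[|[|//]]] ?]; rewrite !mxE.
have sA : (A7 K)^T = A7 K.
  by apply/matrixP => -[[|[|[|//]]] ?] [[|[|[|//]]] ?]; rewrite !mxE.
have sS i j : S i j = S j i by rewrite /S -[in LHS](trmx_sinkhorn A0 sA) mxE.
pose k i j := S (inord i) (inord j).
exists (k 0 0)%N, (k 0 1)%N, (k 0 2)%N, (k 1 1)%N, (k 1 2)%N, (k 2 2)%N.
apply/matrixP => i j; have -> : S i j = k i j by rewrite /k !inord_val.
have kS i' j' : k i' j' = k j' i' by rewrite /k sS.
by rewrite mxE; case: i j => [[|[|[|//]]] ?] [[|[|[|//]]] ?] //=; rewrite kS.
Qed.

(* In item (5) the entry c has |K - 1| where the informal text has K - 1: the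
   two agree for K > 1, and for K < 1 the printed c would be negative. *)
Theorem theorem3 (R : realType) (K : R) (K_gt0 : 0 < K) (K_neq1 : K != 1) :
  complete_representatives (@mx_sim R 3) (symmetric_1K K)
    (tnth [tuple A1 K; A2 K; A3 K; A4 K; A5 K; A6 K; A7 K])
  /\
  (let a := K / (K + 2) in
   let b := 1 / (K + 2) in
   sinkhorn (A1 K) = mx3 [:: [:: a; b; b];
                             [:: b; a; b];
                             [:: b; b; a]])
  /\
  (let a := (2 * K + 1 - Num.sqrt (8 * K + 1)) / (2 * (K - 1)) in
   let b := (- 3 + Num.sqrt (8 * K + 1)) / (4 * (K - 1)) in
   let c := (4 * K - 1 - Num.sqrt (8 * K + 1)) / (8 * (K - 1)) in
   let S := mx3 [:: [:: a; b; b];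
                    [:: b; c; c];
                    [:: b; c; c]] in
   sinkhorn (A2 K) = S /\ sinkhorn (A3 K) = S)
  /\
  (let a := (- K ^+ 2 - 2 + K * Num.sqrt (K ^+ 2 + 8)) /
            (2 * (K ^+ 2 - 1)) in
   let b := (3 * K ^+ 2 - K * Num.sqrt (K ^+ 2 + 8)) /
            (4 * (K ^+ 2 - 1)) in
   let c := (K ^+ 2 - 4 + K * Num.sqrt (K ^+ 2 + 8)) /
            (8 * (K ^+ 2 - 1)) in
   sinkhorn (A4 K) = mx3 [:: [:: a; b; b];
                             [:: b; c; c];
                             [:: b; c; c]])
  /\
  (let a := K * (2 * K + 1 - Num.sqrt (4 * K + 5)) /
            (2 * (K ^+ 2 - 1)) in
   let b := (2 * K + 1 - Num.sqrt (4 * K + 5)) /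
            (2 * (K ^+ 2 - 1)) in
   let c := Num.sqrt (2 * K + 7 - 3 * Num.sqrt (4 * K + 5)) /
            (Num.sqrt 2 * `|K - 1|) in
   let d := (K + 2 - Num.sqrt (4 * K + 5)) / (K - 1) in
   sinkhorn (A5 K) = mx3 [:: [:: a; b; c];
                             [:: b; a; c];
                             [:: c; c; d]])
  /\
  (let a := (K `^ (2 / 3) - K `^ (1 / 3)) / (K - 1) in
   let b := (K - K `^ (2 / 3)) / (K - 1) in
   let c := (K `^ (1 / 3) - 1) / (K - 1) in
   sinkhorn (A6 K) = mx3 [:: [:: a; b; c];
                             [:: b; c; a];
                             [:: c; a; b]])
  /\
  (exists a b c d e f : R,
   sinkhorn (A7 K) = mx3 [:: [:: a; b; c];
                             [:: b; d; e];
                             [:: c; e; f]]).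
Proof.
split; first exact: classification.
split; first exact: sinkhorn_A1.
split; first by apply: sinkhorn_A2_A3; rewrite ?sqrtr_ge0// sqr_sqrtr//; lra.
split.
  by apply: sinkhorn_A4; rewrite ?sqrtr_ge0// sqr_sqrtr// addr_ge0 ?sqr_ge0.
split; first by apply: sinkhorn_A5; rewrite ?sqrtr_ge0// sqr_sqrtr//; lra.
split; last exact: sinkhorn_A7_symmetric.
have -> : K `^ (2 / 3) = (K `^ (1 / 3)) ^+ 2.
  rewrite -powR_mulrn ?powR_ge0// -powRrM; congr (_ `^ _).
  by field.
apply: sinkhorn_A6 => //; first exact: powR_gt0.
rewrite -powR_mulrn ?powR_ge0// -powRrM (_ : 1 / 3 * 3 = 1) ?powRr1 ?ltW//.
by field.
Qed.
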